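(* In the sweeping setting of the context, assume (F.1) and (F.2), and assume that $\big(\gamma_k\,\omega(d_{\mathcal C}\gamma_k)\big)_{k}\in\ell^1$. Then the error summability condition holds: $\big(\gamma_{k+1}\|\lambda_{k+1}\|\big)_k\in\ell^1$.
   Context: **Problem.** $\mathcal H$ is a real Hilbert space, $\mathcal C\subset\mathcal H$ is convex, weakly compact with diameter $d_{\mathcal C}=\sup_{x,y\in\mathcal C}\|x-y\|$, $A$ is a bounded linear operator from $\mathcal H$ to a real Hilbert space, $b\in\operatorname{ran}A$, $n>1$ is a fixed integer, and the problem is $\min_{x\in\mathcal C,\ Ax=b} f(x)$ with $f=\frac1n\sum_{i=1}^nf_i$. **$\omega$-smoothness.** Given $\omega:[0,\infty[\to[0,\infty[$ with $\omega(0)=0$ and $s\mapsto\int_0^1\omega(st)\,dt$ nondecreasing, a differentiable function $\varphi$ is $\omega$-smooth if $\|\nabla\varphi(x)-\nabla\varphi(y)\|\le\omega(\|x-y\|)$ for all $x,y$. (F.1) $f_i$ is $\omega$-smooth for $1\le i\le n$ with $\omega$ nondecreasing. (F.2) $(\gamma_k)$ is nonincreasing. **Iteration (ICGALP for this problem).** With $x_0\in\mathcal C$, $\mu_0\in\operatorname{ran}A$, $z_k=\widehat\nabla f_k+A^*\mu_k+\rho_kA^*(Ax_k-b)$, $\widehat s_k\in\mathcal C$ a (possibly inexact) minimizer of $\langle z_k,\cdot\rangle$ over $\mathcal C$, $x_{k+1}=x_k-\gamma_k(x_k-\widehat s_k)$, $\mu_{k+1}=\mu_k+\theta_k(Ax_{k+1}-b)$,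 where $\gamma_k\in]0,1]$ and $\rho_k,\theta_k\ge0$. Write $[k]=k\bmod n\in\{1,\dots,n\}$ (with the convention $[n]=n$). The inexact gradient is $$\widehat\nabla f_k=\frac1n\sum_{i=1}^k\nabla f_i(x_i)\quad(k\le n),\qquad \widehat\nabla f_k=\widehat\nabla f_{k-1}+\frac1n\big(\nabla f_{[k]}(x_k)-\nabla f_{[k]}(x_{k-n})\big)\quad(k\ge n+1),$$ and the gradient error is $\lambda_k=\widehat\nabla f_k-\nabla f(x_k)$. *)

(* Defs.v *)
From HB Require Import structures.
From mathcomp Require Import all_boot all_order all_algebra.
From mathcomp Require Import all_classical all_reals all_analysis.

Set Implicit Arguments.
Unset Strict Implicit.
Unset Printing Implicit Defensive.

Import Order.TTheory GRing.Theory Num.Theory.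
Import numFieldNormedType.Exports.

Local Open Scope classical_set_scope.
Local Open Scope ring_scope.

(* A real Hilbert space is a [completeNormedModType R] together with an inner
   product inducing its norm. *)
Definition hilbert_product (R : realType) (H : completeNormedModType R)
    (dot : {dot H for idfun}) : Prop :=
  forall x : H, `|x| ^+ 2 = dot x x.

(* Compactness in the weak topology, the coarsest one making the functionals
   [fun x => dot x y] continuous for all [y]: it is induced by the topology of
   pointwise convergence through [x |-> (y |-> dot x y)]. *)
Definition weakly_compact (R : realType) (H : completeNormedModType R)
    (dot : {dot H for idfun}) (C : set H) : Prop :=
  @compact (initial_topology (fun x : H => (fun y : H => dot x y)
                                : {ptws H -> R})) C.

(* Only meaningful for bounded [C]; weakly compact sets are bounded. *)
Definition diameter (R : realType) (H : completeNormedModType R)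
    (C : set H) : R :=
  sup [set r | exists x y, [/\ C x, C y & r = `|x - y|]].

(* [adjoint] and [gradient] are given by Riesz representation: the vector they
   pick exists and is unique when [A] is bounded, resp. when [phi] is
   differentiable at [x]; otherwise they may take the junk value 0. *)
Definition adjoint (R : realType) (H K : completeNormedModType R)
    (dotH : {dot H for idfun}) (dotK : {dot K for idfun})
    (A : H -> K) (y : K) : H :=
  xget 0 [set z : H | forall x : H, dotK (A x) y = dotH x z].

Definition gradient (R : realType) (H : completeNormedModType R)
    (dot : {dot H for idfun}) (phi : H -> R^o) (x : H) : H :=
  xget 0 [set g : H | forall h : H, 'd phi x h = dot g h].

(* Functions on [0, +oo[ are represented by functions on R whose values at
   negative arguments are irrelevant. *)
Definition smoothness_modulus (R : realType) (omega : R -> R) : Prop :=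
  [/\ forall t, 0 <= t -> 0 <= omega t,
      omega 0 = 0 &
      forall s s', 0 <= s -> s <= s' ->
        (\int[@lebesgue_measure R]_(t in `[0%R, 1%R]) (omega (s * t))%:E <=
         \int[@lebesgue_measure R]_(t in `[0%R, 1%R]) (omega (s' * t))%:E)%E].

Definition omega_smooth (R : realType) (H : completeNormedModType R)
    (dot : {dot H for idfun}) (omega : R -> R) (phi : H -> R^o) : Prop :=
  (forall x, differentiable phi x) /\
  (forall x y, `|gradient dot phi x - gradient dot phi y| <= omega `|x - y|).

(* Families f_1, ..., f_n are indexed by nat; only the values at 1, ..., n are
   relevant. *)
Definition average (R : realType) (H : completeNormedModType R) (n : nat)
    (f : nat -> H -> R^o) : H -> R^o :=
  fun x => n%:R^-1 * \sum_(1 <= i < n.+1) f i x.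

(* k mod n, with representatives in {1, ..., n}. *)
Definition sweep_index (n k : nat) : nat :=
  if (n %| k)%N then n else (k %% n)%N.

Fixpoint sweep_gradient (R : realType) (H : completeNormedModType R)
    (dot : {dot H for idfun}) (n : nat) (f : nat -> H -> R^o) (x : nat -> H)
    (k : nat) : H :=
  if (k <= n)%N then
    n%:R^-1 *: \sum_(1 <= i < k.+1) gradient dot (f i) (x i)
  else if k is k'.+1 then
    sweep_gradient dot n f x k' +
    n%:R^-1 *: (gradient dot (f (sweep_index n k)) (x k) -
                gradient dot (f (sweep_index n k)) (x (k - n)%N))
  else 0.

Definition gradient_error (R : realType) (H : completeNormedModType R)
    (dot : {dot H for idfun}) (n : nat) (f : nat -> H -> R^o) (x : nat -> H)
    (k : nat) : H :=
  sweep_gradient dot n f x k - gradient dot (average n f) (x k).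

(* [delta k] is the tolerance allowed in the minimization of [dot (z k)]
   over [C]. *)
Record sweeping_icgalp (R : realType) (H K : completeNormedModType R)
    (dotH : {dot H for idfun}) (dotK : {dot K for idfun})
    (C : set H) (A : H -> K) (b : K) (n : nat) (f : nat -> H -> R^o)
    (gamma rho theta delta : nat -> R)
    (x z s : nat -> H) (mu : nat -> K) : Prop := SweepingICGALP {
  icgalp_x0 : C (x 0%N);
  icgalp_mu0 : range A (mu 0%N);
  icgalp_gamma : forall k, 0 < gamma k <= 1;
  icgalp_rho : forall k, 0 <= rho k;
  icgalp_theta : forall k, 0 <= theta k;
  icgalp_delta : forall k, 0 <= delta k;
  icgalp_z : forall k, z k = sweep_gradient dotH n f x k
    + adjoint dotH dotK A (mu k)
    + rho k *: adjoint dotH dotK A (A (x k) - b);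
  icgalp_s : forall k, C (s k);
  icgalp_min : forall k y, C y -> dotH (z k) (s k) <= dotH (z k) y + delta k;
  icgalp_x : forall k, x k.+1 = x k - gamma k *: (x k - s k);
  icgalp_mu : forall k, mu k.+1 = mu k + theta k *: (A (x k.+1) - b)
}.

Definition ell1 (R : realType) (u : nat -> R) : Prop :=
  cvgn [normed series u].

(* Main.v *)
Require Import Defs.
From HB Require Import structures.
From mathcomp Require Import all_boot all_order all_algebra.
From mathcomp Require Import all_classical all_reals all_analysis.
From mathcomp Require Import ring lra.
Set Implicit Arguments.
Unset Strict Implicit.
Unset Printing Implicit Defensive.
Import Order.TTheory GRing.Theory Num.Theory.
Import numFieldNormedType.Exports.
Local Open Scope classical_set_scope.
Local Open Scope ring_scope.

(** Once n steps have been made, the sweeping gradient at step k is the average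
    of the gradients of f_[j] at x_j over the last n indices j.  These indices
    meet each residue modulo n exactly once, so the gradient of f at x_k is the
    average of the gradients of f_[j] at x_k over the same window, and the error
    lambda_k is an average of n differences of gradients of one f_[j] between
    the points x_j and x_k.

    The modulus omega is not assumed to be subadditive, so the bound
    omega (|x_j - x_k|) of such a difference does not lead back to the values
    omega (d_C gamma_i).  Instead the difference is telescoped along the iterates
    x_j, x_{j+1}, ..., x_k: omega then only sees single steps, whose lengths are
    at most d_C gamma_i.  Hence |lambda_k| is at most the sum
    of omega (d_C gamma_i) over the n indices i that precede k
    ([gradient_error_le]).  As gamma is nonincreasing, gamma_k can be moved
    inside that sum and replaced by gamma_i.  The sequence
    gamma_k |lambda_k| is thus dominated by sums of n consecutive terms of a
    summable sequence, and is summable ([ell1_window]).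

    Two facts about Hilbert spaces enter.  The gradient of a sum is the sum of
    the gradients only because every continuous linear functional is represented
    by a vector ([riesz_representation]).  And the supremum that defines the
    diameter bounds the distances in C because a weakly compact set is bounded
    ([weakly_compact_bounded]), by the uniform boundedness principle. *)

(** * Inner products *)

Lemma dotC (R : realType) (H : completeNormedModType R)
    (dot : {dot H for idfun}) (x y : H) : dot x y = dot y x.
Proof. by rewrite hermC /= expr0 mul1r. Qed.

Lemma dotDl (R : realType) (H : completeNormedModType R)
    (dot : {dot H for idfun}) (x y z : H) :
  dot (x + y) z = dot x z + dot y z.
Proof. exact: linearDl. Qed.

Lemma dotZl (R : realType) (H : completeNormedModType R)
    (dot : {dot H for idfun}) (a : R) (x z : H) :
  dot (a *: x) z = a * dot x z.
Proof. exact: linearZl_LR. Qed.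

Lemma dotDr (R : realType) (H : completeNormedModType R)
    (dot : {dot H for idfun}) (x y z : H) :
  dot z (x + y) = dot z x + dot z y.
Proof. by rewrite dotC dotDl !(dotC dot z). Qed.

Lemma dotZr (R : realType) (H : completeNormedModType R)
    (dot : {dot H for idfun}) (a : R) (x z : H) :
  dot z (a *: x) = a * dot z x.
Proof. by rewrite dotC dotZl (dotC dot z). Qed.

Lemma sqr_normD (R : realType) (H : completeNormedModType R)
    (dot : {dot H for idfun}) : hilbert_product dot ->
  forall x y : H, `|x + y| ^+ 2 = `|x| ^+ 2 + 2 * dot x y + `|y| ^+ 2.
Proof.
move=> hilb x y; rewrite !hilb dotDl !dotDr (dotC dot y x).
ring.
Qed.

Lemma parallelogram (R : realType) (H : completeNormedModType R)
    (dot : {dot H for idfun}) : hilbert_product dot ->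
  forall x y : H, `|x + y| ^+ 2 + `|x - y| ^+ 2 = 2 * (`|x| ^+ 2 + `|y| ^+ 2).
Proof.
move=> hilb x y; rewrite -scaleN1r !(sqr_normD hilb) normrZ dotZr normrN1.
ring.
Qed.

(** The triangle inequality is already part of the norm; expanding its square
    leaves exactly this bound. *)
Lemma cauchy_schwarz (R : realType) (H : completeNormedModType R)
    (dot : {dot H for idfun}) : hilbert_product dot ->
  forall x y : H, `|dot x y| <= `|x| * `|y|.
Proof.
move=> hilb.
have dot_le (x y : H) : dot x y <= `|x| * `|y|.
  have : `|x + y| ^+ 2 <= (`|x| + `|y|) ^+ 2.
    by rewrite ler_pXn2r ?nnegrE ?addr_ge0// ler_normD.
  rewrite (sqr_normD hilb) sqrrD; lra.
move=> x y; rewrite ler_norml dot_le andbT lerNl.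
by have := dot_le (-1 *: x) y; rewrite dotZl normrZ normrN1 mulN1r mul1r.
Qed.

(** The first-order optimality condition for a quadratic function of one
    variable that is minimal at 0. *)
Lemma quadratic_ge0_linear_coef0 (R : realType) (a b : R) :
  (forall t, 0 <= t ^+ 2 * a + 2 * t * b) -> b = 0.
Proof.
move=> ge0.
have a0 : 0 <= a by have := ge0 1; have := ge0 (-1); rewrite sqrrN expr1n; lra.
have d0 : 0 < a + 1 by lra.
(* The minimizer is - b / a; adding 1 also covers the case a = 0. *)
have := ge0 (- b / (a + 1)).
have -> : (- b / (a + 1)) ^+ 2 * a + 2 * (- b / (a + 1)) * b =
  - (b ^+ 2 * ((a + 2) / (a + 1) ^+ 2)) by field; rewrite gt_eqF.
rewrite oppr_ge0 pmulr_lle0; last by rewrite divr_gt0 ?exprn_gt0//; lra.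
by move=> b2; apply/eqP; rewrite -sqrf_eq0 eq_le b2 sqr_ge0.
Qed.

(** The representing vector minimizes q h = |h|^2 - 2 L h.  By the parallelogram
    identity two near-minimizers of q are close to each other, so a minimizing
    sequence converges by completeness; at its limit g the derivative of q
    vanishes in every direction, which says that L h = dot g h. *)
Lemma riesz_representation (R : realType) (H : completeNormedModType R)
    (dot : {dot H for idfun}) (hilb : hilbert_product dot)
    (L : {linear H -> R^o}) :
  continuous L -> exists g : H, forall h, L h = dot g h.
Proof.
move=> Lc.
have [r r0 Lr] : exists2 r : R, 0 < r & forall h, `|L h| <= r * `|h|.
  have /linear_bounded_continuous/linear_boundedP := Lc.
  move=> /pinfty_ex_gt0[r r0 Lr].
  by exists r.
pose q (h : H) : R := `|h| ^+ 2 - 2 * L h.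
pose m := inf (range q).
have qlb : has_inf (range q).
  split; first by exists (q 0); exists 0.
  exists (- r ^+ 2) => _ [h _ <-]; rewrite /q.
  have := Lr h; rewrite ler_norml => /andP[_ Lh].
  have := sqr_ge0 (`|h| - r); rewrite sqrrB; lra.
have m_le h : m <= q h by apply: ge_inf; [exact: qlb.2|exists h].
(* Comparison of q at h and k with its value at their midpoint. *)
have mid (h k : H) : `|h - k| ^+ 2 <= 2 * (q h + q k - 2 * m).
  have := m_le (2^-1 *: (h + k)); have := parallelogram hilb h k.
  have LE : L (2^-1 *: (h + k)) = 2^-1 * (L h + L k).
    by rewrite linearZ linearD.
  rewrite /q LE normrZ exprMn ger0_norm ?invr_ge0//.
  set A := `|_ + _| ^+ 2; set B := `|_ - _| ^+ 2.
  rewrite exprVn; lra.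
have near_inf n : exists h, q h < m + n.+1%:R^-1.
  have i0 : 0 < n.+1%:R^-1 :> R by rewrite invr_gt0.
  by have [_ [h _ <-] qh] := inf_adherent i0 qlb; exists h.
have [u qu] := choice near_inf.
have inv_cvg : (fun n => m + n.+1%:R^-1 : R) @ \oo --> m.
  rewrite -[X in _ --> X]addr0; apply: cvgD; first exact: cvg_cst.
  exact: cvg_harmonic.
have : cvgn u.
  have w_small (e : R) : 0 < e -> \forall n \near \oo, n.+1%:R^-1 < e.
    move=> e0; near=> n; have : `|n.+1%:R^-1 : R| < e.
      by near: n; have /cvgr0_norm_lt := @cvg_harmonic R; apply.
    exact: le_lt_trans (ler_norm _).
  apply/cauchy_cvgP/cauchy_ballP => e; move: (e : R) => {}e e0.
  have e20 : 0 < e ^+ 2 / 4 by rewrite divr_gt0 ?exprn_gt0.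
  near_simpl; near=> i j => /=; rewrite -ball_normE /=.
  rewrite -(@ltr_pXn2r _ 2) ?nnegrE ?(ltW e0)//.
  apply: (le_lt_trans (mid _ _)).
  have Hi : i.+1%:R^-1 < e ^+ 2 / 4 by near: i; exact: w_small.
  have Hj : j.+1%:R^-1 < e ^+ 2 / 4 by near: j; exact: w_small.
  move: Hi Hj (qu i) (qu j).
  move: (i.+1%:R^-1) (j.+1%:R^-1) (q (u i)) (q (u j)) (e ^+ 2).
  move=> /= a b c d E; lra.
move=> /cvg_ex[/= g ug].
have qg : q g = m.
  have qu_cvg : (q \o u) @ \oo --> q g.
    apply: cvgB.
      by apply: cvgM; exact: (cvg_norm ug).
    apply: cvgM; first exact: cvg_cst.
    by apply: (continuous_cvg _ (Lc g)).
  have qu_m : (q \o u) @ \oo --> m.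
    apply: (squeeze_cvgr _ (cvg_cst m) inv_cvg).
    by apply: nearW => n /=; rewrite m_le ltW.
  exact: (cvg_unique _ qu_cvg qu_m).
exists g => h; apply/eqP; rewrite eq_sym -subr_eq0; apply/eqP.
apply: (@quadratic_ge0_linear_coef0 _ (`|h| ^+ 2)) => t.
have LE : L (g + t *: h) = L g + t * L h by rewrite linearD linearZ.
have := m_le (g + t *: h).
rewrite -qg /q (sqr_normD hilb) LE dotZr normrZ exprMn real_normK ?num_real//.
move: (t ^+ 2 * _) => A; lra.
Unshelve. all: by end_near. Qed.

(** * Gradients *)

Lemma gradientP (R : realType) (H : completeNormedModType R)
    (dot : {dot H for idfun}) (hilb : hilbert_product dot)
    (phi : H -> R^o) (x : H) :
  differentiable phi x ->
  forall h, 'd phi x h = dot (gradient dot phi x) h.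
Proof.
move=> dphi; have [g dg] := riesz_representation hilb (diff_continuous dphi).
exact: (@xgetPex _ 0 [set g : H | forall h : H, 'd phi x h = dot g h]
  (ex_intro _ g dg)).
Qed.

Lemma gradient_unique (R : realType) (H : completeNormedModType R)
    (dot : {dot H for idfun}) (hilb : hilbert_product dot)
    (phi : H -> R^o) (x g : H) :
  differentiable phi x -> (forall h, 'd phi x h = dot g h) ->
  gradient dot phi x = g.
Proof.
move=> dphi dg; apply/eqP; rewrite -subr_eq0 -normr_eq0 -sqrf_eq0 hilb.
rewrite -scaleN1r dotDl dotZl mulN1r -dg.
by rewrite -(gradientP hilb dphi) subrr.
Qed.

Lemma is_diff_sum_nat (R : realType) (V W : normedModType R) (m n : nat)
    (f df : nat -> V -> W) (x : V) :
  (forall i, (m <= i < n)%N -> is_diff x (f i) (df i)) ->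
  is_diff x (fun y => \sum_(m <= i < n) f i y)
            (fun h => \sum_(m <= i < n) df i h).
Proof.
have [nm _|] := leqP n m.
  have E (g : nat -> V -> W) : (fun y => \sum_(m <= i < n) g i y) = cst 0.
    by apply/funext => y; rewrite big_geq.
  by rewrite !E; exact: is_diff_cst.
elim: n => // n IHn; rewrite ltnS leq_eqVlt => /predU1P[<- d|mn d].
  have E (g : nat -> V -> W) : (fun y => \sum_(m <= i < m.+1) g i y) = g m.
    by apply/funext => y; rewrite big_nat1.
  by rewrite !E; apply: d; rewrite leqnn ltnSn.
have E (g : nat -> V -> W) : (fun y => \sum_(m <= i < n.+1) g i y) =
    (fun y => \sum_(m <= i < n) g i y) + g n.
  by apply/funext => y; rewrite big_nat_recr ?(ltnW mn).
rewrite !E; apply: is_diffD; last by apply: d; rewrite ltnW/=.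
by apply: IHn => // i /andP[mi iN]; apply: d; rewrite mi ltnW.
Qed.

Lemma gradient_average (R : realType) (H : completeNormedModType R)
    (dot : {dot H for idfun}) (hilb : hilbert_product dot)
    (n : nat) (f : nat -> H -> R^o) (x : H) :
  (forall i, (1 <= i <= n)%N -> differentiable (f i) x) ->
  gradient dot (average n f) x =
    n%:R^-1 *: \sum_(1 <= i < n.+1) gradient dot (f i) x.
Proof.
move=> df.
have dfi i : (1 <= i < n.+1)%N -> is_diff x (f i) ('d (f i) x).
  by move=> i1n; apply: DiffDef => //; exact: df.
have [avg_diff avgE] := is_diffZ n%:R^-1 (is_diff_sum_nat dfi).
apply: gradient_unique => // h.
rewrite avgE dotZl.
congr (_ * _).
transitivity (\sum_(1 <= i < n.+1) dot (gradient dot (f i) x) h).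
  by apply: eq_big_nat => i i1n; rewrite -(gradientP hilb (df i i1n)).
by elim/big_rec2: _ => [|i y1 y2 _ ->]; rewrite ?dotDl// linear0l.
Qed.

(** * Weakly compact sets *)

(** Evaluation at y is weakly continuous, so the functionals [dot c], for c in C,
    are pointwise bounded; the uniform boundedness principle bounds their
    operator norms, which are the norms of the points c. *)
Lemma weakly_compact_bounded (R : realType) (H : completeNormedModType R)
    (dot : {dot H for idfun}) (hilb : hilbert_product dot) (C : set H) :
  weakly_compact dot C -> exists M, forall c, C c -> `|c| <= M.
Proof.
move=> Cc.
pose F := [set (fun y : H => dot c y : R^o) | c in C].
have [||M FM] := @Banach_Steinhauss R H R^o F _ _ 1.
- move=> _ [c Cc' <-]; split.
    move=> r; exists (`|c| * r) => y yr.
    by rewrite (le_trans (cauchy_schwarz hilb _ _))// ler_wpM2l.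
  by move=> a y y'; rewrite dotDr dotZr.
- move=> y.
  have : compact [set (dot c y : R^o) | c in C].
    apply: continuous_compact Cc; apply: continuous_subspaceT => c.
    apply: (@continuous_comp _ {ptws H -> R} R _ (@proj H (fun=> R) y)).
      exact: initial_continuous.
    exact: proj_continuous.
  move=> /compact_bounded/pinfty_ex_gt0[r _ rC].
  by exists r => _ [c Cc' <-]; apply: rC; exists c.
exists M => c Cc'.
have [->|c0] := eqVneq c 0.
  rewrite normr0; apply: le_trans (FM _ _ 0 _) => //; last by rewrite normr0.
  by exists c.
have -> : `|c| = dot c (`|c|^-1 *: c).
  by rewrite dotZr -hilb expr2 mulrA mulVf ?mul1r ?normr_eq0.
apply: le_trans (ler_norm _) (FM _ _ _ _); first by exists c.
by rewrite normrZ normfV normr_id mulVf ?normr_eq0.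
Qed.

(** * Iterates *)

(** Boundedness excludes the default value 0 of the supremum of an unbounded
    set. *)
Lemma le_diameter (R : realType) (H : completeNormedModType R) (C : set H) :
  (exists M, forall c, C c -> `|c| <= M) ->
  forall x y, C x -> C y -> `|x - y| <= diameter C.
Proof.
move=> [M CM] x y Cx Cy; apply: ub_le_sup; last by exists x, y.
exists (M + M) => _ [x' [y' [Cx' Cy' ->]]].
by rewrite (le_trans (ler_normB _ _))// lerD ?CM.
Qed.

(** Each iterate is a convex combination of the previous one and of a point
    of C. *)
Lemma icgalp_in (R : realType) (H K : completeNormedModType R)
    (dotH : {dot H for idfun}) (dotK : {dot K for idfun})
    (C : set H) (A : H -> K) (b : K) (n : nat) (f : nat -> H -> R^o)
    (gamma rho theta delta : nat -> R)
    (x z s : nat -> H) (mu : nat -> K) :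
  convex_set (C : set (convex_lmodType H)) ->
  sweeping_icgalp dotH dotK C A b n f gamma rho theta delta x z s mu ->
  forall k, C (x k).
Proof.
move=> Cconv algo; elim=> [|k Cxk]; first exact: icgalp_x0 algo.
have /andP[/ltW g0 g1] := icgalp_gamma algo k.
have := Cconv (s k) (x k) (Itv01 g0 g1); rewrite !inE.
move=> /(_ (icgalp_s algo k) Cxk) /=.
suff -> : conv (Itv01 g0 g1) (s k : convex_lmodType H) (x k) = x k.+1 by [].
rewrite [LHS](_ : _ = gamma k *: s k + (1 - gamma k) *: x k)//.
rewrite (icgalp_x algo) scalerBl scale1r scalerBr opprB.
by rewrite addrCA addrA.
Qed.

Lemma icgalp_step (R : realType) (H K : completeNormedModType R)
    (dotH : {dot H for idfun}) (dotK : {dot K for idfun})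
    (C : set H) (A : H -> K) (b : K) (n : nat) (f : nat -> H -> R^o)
    (gamma rho theta delta : nat -> R)
    (x z s : nat -> H) (mu : nat -> K) :
  convex_set (C : set (convex_lmodType H)) ->
  (exists M, forall c, C c -> `|c| <= M) ->
  sweeping_icgalp dotH dotK C A b n f gamma rho theta delta x z s mu ->
  forall k, `|x k - x k.+1| <= diameter C * gamma k.
Proof.
move=> Cconv Cbnd algo k.
have /andP[g0 _] := icgalp_gamma algo k.
rewrite (icgalp_x algo) opprB addrC subrK normrZ gtr0_norm// mulrC.
rewrite ler_wpM2r ?(ltW g0)// le_diameter//; last exact: icgalp_s algo k.
exact: icgalp_in Cconv algo k.
Qed.

(** * Sliding windows and the sweeping gradient *)

Lemma sweep_index_id n i : (1 <= i <= n)%N -> sweep_index n i = i.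
Proof.
move=> /andP[i0]; rewrite /sweep_index leq_eqVlt => /predU1P[->|i_n].
  by rewrite dvdnn.
by rewrite gtnNdvd// modn_small.
Qed.

Lemma sweep_indexDr n k : sweep_index n (k + n) = sweep_index n k.
Proof. by rewrite /sweep_index dvdn_addl// modnDr. Qed.

Lemma sweep_index_bounds n k : (0 < n)%N -> (1 <= sweep_index n k <= n)%N.
Proof.
rewrite /sweep_index /dvdn => n0; case: eqVneq => [_|k0].
  by rewrite n0 leqnn.
by rewrite lt0n k0 ltnW ?ltn_mod.
Qed.

Lemma window_sumS (V : zmodType) (F : nat -> V) m n :
  \sum_(m.+1 <= j < (m.+1 + n)) F j =
  \sum_(m <= j < (m + n)) F j + (F (m + n)%N - F m).
Proof.
apply/eqP; rewrite addrA eq_sym subr_eq [eqbRHS]addrC -big_ltn; last first.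
  by rewrite ltn_addr.
by rewrite addSn big_nat_recr ?leq_addr.
Qed.

Lemma window_sum_from0 (V : zmodType) (F : nat -> V) m n :
  \sum_(m <= i < m + n) F i = \sum_(0 <= i < n) F (m + i)%N.
Proof.
rewrite -{1}[m]add0n big_addn addKn.
by apply: eq_bigr => i _; rewrite addnC.
Qed.

(** Sliding the window by one exchanges two indices that are congruent
    modulo n. *)
Lemma window_sum_sweep (V : zmodType) (F : nat -> V) m n :
  \sum_(m.+1 <= j < m.+1 + n) F (sweep_index n j) = \sum_(1 <= i < n.+1) F i.
Proof.
elim: m => [|m IHm]; last by rewrite window_sumS IHm sweep_indexDr subrr addr0.
by apply: eq_big_nat => i i1n; rewrite sweep_index_id.
Qed.

(** The recursion of the sweeping gradient adds the newest term of the window and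
    subtracts the oldest one. *)
Lemma sweep_gradient_window (R : realType) (H : completeNormedModType R)
    (dot : {dot H for idfun}) n (f : nat -> H -> R^o) (x : nat -> H) m :
  sweep_gradient dot n f x (n + m) =
  n%:R^-1 *: \sum_(m.+1 <= j < m.+1 + n)
    gradient dot (f (sweep_index n j)) (x j).
Proof.
elim: m => [|m IHm].
  have -> : sweep_gradient dot n f x (n + 0) =
      n%:R^-1 *: \sum_(1 <= i < n.+1) gradient dot (f i) (x i).
    by rewrite addn0; case: n => [|n] /=; rewrite ?leqnn.
  rewrite add1n; apply: (congr1 ( *:%R n%:R^-1)).
  rewrite [RHS]big_nat_cond [LHS]big_nat_cond.
  apply: eq_bigr => i /andP[i1n _].
  by rewrite sweep_index_id.
rewrite window_sumS scalerDr -IHm addnS /= ltnNge leq_addr /=.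
by rewrite -addnS addKn -(sweep_indexDr n m.+1) (addnC n m.+1).
Qed.

Lemma ler_dist_chain (R : realType) (V : normedModType R) (u : nat -> V) a b :
  (a <= b)%N -> `|u a - u b| <= \sum_(a <= i < b) `|u i - u i.+1|.
Proof.
move=> ab; rewrite distrC -telescope_sumr//.
by rewrite (le_trans (ler_norm_sum _ _ _))// ler_sum// => i _; rewrite distrC.
Qed.

Lemma gradient_error_window (R : realType) (H : completeNormedModType R)
    (dot : {dot H for idfun}) (hilb : hilbert_product dot)
    (n : nat) (f : nat -> H -> R^o) (x : nat -> H) (m : nat) :
  (forall i y, (1 <= i <= n)%N -> differentiable (f i) y) ->
  gradient_error dot n f x (n + m) =
  n%:R^-1 *: \sum_(m.+1 <= j < m.+1 + n)
    (gradient dot (f (sweep_index n j)) (x j) -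
     gradient dot (f (sweep_index n j)) (x (n + m)%N)).
Proof.
move=> df; rewrite /gradient_error sweep_gradient_window gradient_average//.
  rewrite -(window_sum_sweep (fun i => gradient dot (f i) (x (n + m)%N)) m).
  by rewrite sumrB scalerBr.
by move=> i i1n; exact: df.
Qed.

(** A direct comparison of x_j with x_(n+m) would evaluate omega at a sum of step
    lengths; telescoping the gradients along the iterates evaluates it at single
    steps. *)
Lemma gradient_error_le (R : realType) (H : completeNormedModType R)
    (dot : {dot H for idfun}) (hilb : hilbert_product dot)
    (n : nat) (n_gt0 : (0 < n)%N) (f : nat -> H -> R^o) (omega : R -> R)
    (omega_ge0 : forall t, 0 <= t -> 0 <= omega t)
    (f_smooth : forall i, (1 <= i <= n)%N -> omega_smooth dot omega (f i))
    (x : nat -> H) (m : nat) :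
  `|gradient_error dot n f x (n + m)| <=
    \sum_(m <= i < m + n) omega `|x i - x i.+1|.
Proof.
rewrite gradient_error_window//; last first.
  by move=> i y /f_smooth[].
set S := \sum_(m <= i < m + n) _.
rewrite normrZ ger0_norm ?invr_ge0// ler_pdivrMl ?ltr0n//.
rewrite (le_trans (ler_norm_sum _ _ _))//.
have -> : n%:R * S = \sum_(m.+1 <= j < m.+1 + n) S.
  by rewrite sumr_const_nat addKn mulr_natl.
rewrite big_nat_cond [leRHS]big_nat_cond.
apply: ler_sum => j; rewrite andbT => /andP[mj]; rewrite addSn ltnS addnC => jn.
have [_ f_lip] := f_smooth _ (sweep_index_bounds j n_gt0).
pose grad_j i := gradient dot (f (sweep_index n j)) (x i).
rewrite (le_trans (ler_dist_chain grad_j jn))//.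
rewrite /S (addnC m) (big_cat_nat (ltnW mj) jn)/=.
rewrite ler_wpDl ?sumr_ge0//.
  by move=> i _; exact: omega_ge0.
by apply: ler_sum => i _; exact: f_lip.
Qed.

(** * Summability of the gradient error *)

(** Summing windows of length n counts each term of u at most n times.  The offset
    p leaves finitely many terms of v unconstrained. *)
Lemma ell1_window (R : realType) (u v : nat -> R) (p n : nat) :
  ell1 u -> (forall m, `|v (p + m)%N| <= \sum_(m <= i < m + n) `|u i|) ->
  ell1 v.
Proof.
move=> /cvg_seq_bounded/bounded_fun_has_ubound[M uM] vu.
have sum_u N : \sum_(0 <= i < N) `|u i| <= M by apply: uM; exists N.
apply: nondecreasing_is_cvgn.
  by apply: nondecreasing_series => k _ _; exact: normr_ge0.
exists (\sum_(0 <= k < p) `|v k| + M *+ n) => _ [N _ <-] /=.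
apply: (@le_trans _ _ (\sum_(0 <= k < p + N) `|v k|)).
  by rewrite (big_cat_nat (leq0n N) (leq_addl p N))/= lerDl sumr_ge0.
rewrite (big_cat_nat (leq0n p) (leq_addr N p))/= lerD2l window_sum_from0.
apply: (@le_trans _ _ (\sum_(0 <= m < N) \sum_(0 <= i < n) `|u (m + i)%N|)).
  by apply: ler_sum => m _; rewrite (le_trans (vu m))// window_sum_from0.
rewrite exchange_big_nat/= -[n in M *+ n]subn0 -sumr_const_nat.
apply: ler_sum => i _; apply: le_trans (sum_u (i + N)%N).
rewrite (big_cat_nat (leq0n i) (leq_addr N i))/= [X in _ <= _ + X]window_sum_from0.
rewrite (eq_bigr (fun m => `|u (i + m)%N|)) => [|m _]; last by rewrite addnC.
by rewrite lerDr sumr_ge0.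
Qed.

Theorem proposition6p2 (R : realType) (H K : completeNormedModType R)
  (dotH : {dot H for idfun}) (dotK : {dot K for idfun})
  (hilbertH : hilbert_product dotH) (hilbertK : hilbert_product dotK)
  (C : set H) (C_convex : convex_set (C : set (convex_lmodType H)))
  (C_compact : weakly_compact dotH C)
  (A : {linear H -> K}) (A_bounded : continuous A)
  (b : K) (b_range : range A b)
  (n : nat) (n_gt1 : (1 < n)%N) (f : nat -> H -> R^o)
  (omega : R -> R) (omega_modulus : smoothness_modulus omega)
  (gamma rho theta delta : nat -> R)
  (x z s : nat -> H) (mu : nat -> K)
  (algo : sweeping_icgalp dotH dotK C A b n f gamma rho theta delta x z s mu)
  (F1_smooth : forall i, (1 <= i <= n)%N -> omega_smooth dotH omega (f i))
  (F1_omega : forall t t', 0 <= t -> t <= t' -> omega t <= omega t')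
  (F2 : nonincreasing_seq gamma)
  (gamma_omega : ell1 (fun k => gamma k * omega (diameter C * gamma k))) :
  ell1 (fun k => gamma k.+1 * `|gradient_error dotH n f x k.+1|).
Proof.
have n_gt0 : (0 < n)%N by exact: ltnW.
have [omega_ge0 _ _] := omega_modulus.
have gamma_ge0 k : 0 <= gamma k.
  by have /andP[/ltW] := icgalp_gamma algo k.
have step k : `|x k - x k.+1| <= diameter C * gamma k.
  have Cbnd := weakly_compact_bounded hilbertH C_compact.
  exact: icgalp_step C_convex Cbnd algo k.
(* The sequence is already shifted by one, so the window bound, valid from index
   n on, starts at n.-1. *)
apply: (@ell1_window _ _ _ n.-1 n gamma_omega) => m.
rewrite -addSn prednK// ger0_norm ?mulr_ge0//.
apply: le_trans (ler_wpM2l (gamma_ge0 _)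
  (gradient_error_le hilbertH n_gt0 omega_ge0 F1_smooth x m)) _.
rewrite mulr_sumr big_nat_cond [leRHS]big_nat_cond.
apply: ler_sum => i /andP[/andP[_ im] _].
apply: le_trans (ler_norm _); apply: ler_pM; rewrite ?omega_ge0//.
  by apply: F2; rewrite addnC ltnW.
exact: F1_omega.
Qed.
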